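(* Let $k$ be a field of characteristic not $2$ or $3$. Let $Mat^{S^2}_2$ be the $k$-algebra of $2\times 6$ matrices over $k$ with the multiplication $\cdot$ described in the context, and let $U^{S^2}_2$ be the collection of $2\times 6$ $S^2$-Upper Triangular Matrices over $k$. Then $U^{S^2}_2$ is a subalgebra of $Mat^{S^2}_2$.
   Context: Columns of a $2\times6$ matrix are indexed, in order, by $(1,2),(1,3),(1,4),(2,3),(2,4),(3,4)$. The multiplication on $Mat^{S^2}_2$ is defined as follows. Let $X$ have first row $(a_{1,2},a_{1,3},a_{1,4},a_{2,3},a_{2,4},a_{3,4})$ and second row $(b_{1,2},b_{1,3},b_{1,4},b_{2,3},b_{2,4},b_{3,4})$, and let $Y$ have first row $(c_{1,2},\dots,c_{3,4})$ and second row $(d_{1,2},\dots,d_{3,4})$, indexed in the same way. Then $X\cdot Y$ is the $2\times 6$ matrix with columns column $(1,2)$: $\begin{pmatrix}a_{1,2}c_{1,2}+a_{3,4}d_{1,2}\\ b_{1,2}c_{1,2}+b_{3,4}d_{1,2}\end{pmatrix}$; column $(1,3)$: $\begin{pmatrix}a_{1,3}c_{1,3}+a_{2,3}d_{1,3}\\ b_{1,3}c_{1,3}+b_{2,3}d_{1,3}\end{pmatrix}$; column $(1,4)$: $\begin{pmatrix}a_{2,4}c_{1,4}+a_{1,4}d_{1,4}\\ b_{2,4}c_{1,4}+b_{1,4}d_{1,4}\end{pmatrix}$; column $(2,3)$: $\begin{pmatrix}a_{1,3}c_{2,3}+a_{2,3}d_{2,3}\\ b_{1,3}c_{2,3}+b_{2,3}d_{2,3}\end{pmatrix}$;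 column $(2,4)$: $\begin{pmatrix}a_{2,4}c_{2,4}+a_{1,4}d_{2,4}\\ b_{2,4}c_{2,4}+b_{1,4}d_{2,4}\end{pmatrix}$; column $(3,4)$: $\begin{pmatrix}a_{1,2}c_{3,4}+a_{3,4}d_{3,4}\\ b_{1,2}c_{3,4}+b_{3,4}d_{3,4}\end{pmatrix}$. Vector space operations are entrywise. A $2\times 6$ matrix is $S^2$-Upper Triangular if for each $(i,j)$ the column indexed $(i,j)$ lies in the span of $e_1,\dots,e_{ind(i,j)}$ ($e_1,e_2$ the standard basis of $k^2$), where $ind(1,2)=ind(1,3)=ind(2,4)=1$ and $ind(1,4)=ind(2,3)=ind(3,4)=2$; i.e. the second-row entries in columns $(1,2),(1,3),(2,4)$ are $0$. A subalgebra is a linear subspace closed under the multiplication. *)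

(* Defs.v *)
From HB Require Import structures.
From mathcomp Require Import all_boot all_order all_algebra.
From mathcomp Require Import ring.

Set Implicit Arguments.
Unset Strict Implicit.
Unset Printing Implicit Defensive.

Import GRing.Theory.
Local Open Scope ring_scope.

                                                                     
                                                                              
Definition c12 : 'I_6 := @Ordinal 6 0 isT.
Definition c13 : 'I_6 := @Ordinal 6 1 isT.
Definition c14 : 'I_6 := @Ordinal 6 2 isT.
Definition c23 : 'I_6 := @Ordinal 6 3 isT.
Definition c24 : 'I_6 := @Ordinal 6 4 isT.
Definition c34 : 'I_6 := @Ordinal 6 5 isT.

                                                                               
Definition MatS2 (k : fieldType) : Type := 'M[k]_(2, 6).

HB.instance Definition _ (k : fieldType) :=
  GRing.Lmodule.copy (MatS2 k) 'M[k]_(2, 6).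

Section MatS2.
Variable k : fieldType.

                                                                            
                                      
Definition mulS2 (X Y : 'M[k]_(2, 6)) : 'M[k]_(2, 6) :=
  \matrix_(r < 2, c < 6) nth 0
    [:: X r c12 * Y 0 c12 + X r c34 * Y 1 c12;
        X r c13 * Y 0 c13 + X r c23 * Y 1 c13;
        X r c24 * Y 0 c14 + X r c14 * Y 1 c14;
        X r c13 * Y 0 c23 + X r c23 * Y 1 c23;
        X r c24 * Y 0 c24 + X r c14 * Y 1 c24;
        X r c12 * Y 0 c34 + X r c34 * Y 1 c34] c.

                                                                         
Definition oneS2 : 'M[k]_(2, 6) :=
  \matrix_(r < 2, c < 6)
    nth 0 (nth [::] [:: [:: 1; 1; 0; 0; 1; 0]; [:: 0; 0; 1; 1; 0; 1]] r) c.

Lemma mulS2A : associative mulS2.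
Proof.
move=> X Y Z; apply/matrixP => r [[|[|[|[|[|[|//]]]]]] hc];
  by rewrite !mxE /=; ring.
Qed.

Lemma ord6P (P : 'I_6 -> Prop) :
  P c12 -> P c13 -> P c14 -> P c23 -> P c24 -> P c34 -> forall c, P c.
Proof.
move=> h0 h1 h2 h3 h4 h5 [[|[|[|[|[|[|//]]]]]] hc];
  by rewrite (bool_irrelevance hc isT).
Qed.

Lemma ord2P (P : 'I_2 -> Prop) : P 0 -> P 1 -> forall r, P r.
Proof.
move=> h0 h1 [[|[|//]] hr].
- by rewrite (_ : Ordinal hr = 0) //; apply: val_inj.
- by rewrite (_ : Ordinal hr = 1) //; apply: val_inj.
Qed.

Lemma mul1S2 : left_id oneS2 mulS2.
Proof.
by move=> X; apply/matrixP; elim/ord2P; elim/ord6P; rewrite !mxE /=; ring.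
Qed.

Lemma mulS21 : right_id oneS2 mulS2.
Proof.
by move=> X; apply/matrixP => r; elim/ord6P; rewrite !mxE /=; ring.
Qed.

Lemma mulS2Dl : left_distributive mulS2 +%R.
Proof.
by move=> X Y Z; apply/matrixP => r; elim/ord6P; rewrite !mxE /=; ring.
Qed.

Lemma mulS2Dr : right_distributive mulS2 +%R.
Proof.
by move=> X Y Z; apply/matrixP => r; elim/ord6P; rewrite !mxE /=; ring.
Qed.

Lemma oneS2_neq0 : oneS2 != 0.
Proof.
by apply/eqP => /matrixP/(_ 0 c12)/eqP; rewrite !mxE /= oner_eq0.
Qed.

HB.instance Definition _ := GRing.Zmodule_isNzRing.Build (MatS2 k)
  mulS2A mul1S2 mulS21 mulS2Dl mulS2Dr oneS2_neq0.

Lemma mulS2E (X Y : MatS2 k) : X * Y = mulS2 X Y.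
Proof. by []. Qed.

Lemma scaleS2Al (a : k) (X Y : MatS2 k) : a *: (X * Y) = (a *: X) * Y.
Proof.
rewrite !mulS2E; apply/matrixP => r.
by elim/ord6P; rewrite !mxE /=; ring.
Qed.

HB.instance Definition _ := GRing.Lmodule_isLalgebra.Build k (MatS2 k) scaleS2Al.

Lemma scaleS2Ar (a : k) (X Y : MatS2 k) : a *: (X * Y) = X * (a *: Y).
Proof.
rewrite !mulS2E; apply/matrixP => r.
by elim/ord6P; rewrite !mxE /=; ring.
Qed.

HB.instance Definition _ := GRing.Lalgebra_isAlgebra.Build k (MatS2 k) scaleS2Ar.

Definition indS2 (c : 'I_6) : nat := nth 0%N [:: 1; 1; 2; 2; 1; 2]%N c.

                                                                           
                                              
Definition upper_triangularS2 (X : MatS2 k) : bool :=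
  [forall c : 'I_6, col c (X : 'M[k]_(2, 6)) \in
     <<[seq (delta_mx i 0 : 'cV[k]_2)%R | i : 'I_2 <- enum 'I_2
        & (i < indS2 c)%N]>>%VS].

Definition US2 : {pred MatS2 k} := [pred X | upper_triangularS2 X].

End MatS2.

Arguments US2 k : clear implicits.

                                                           
Definition is_subalgebra (k : fieldType) (A : algType k) (S : {pred A}) : Prop :=
  GRing.submod_closed S /\ GRing.mulr_2closed S.

(* Main.v *)
Require Import Defs.
From mathcomp Require Import all_boot all_order all_algebra.

Import GRing.Theory.
Local Open Scope ring_scope.

(** Upper triangularity only asks that the second-row entries in columns (1,2),
    (1,3) and (2,4) vanish ([US2P]).  These are linear conditions, so they cut
    out a subspace.  The product preserves them because, in each of these three
    columns, the second row of [X * Y] has the form [b * c + b' * d], where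
    [(c, d)] is the column of [Y] in that position and [b] is a second-row entry
    of [X] in one of the three columns: [b = 0] since [X] is upper triangular,
    and [d = 0] since [Y] is. *)

(** Passing from spans to coordinates: every vector of the spanning family
    vanishes from position [n] on, hence so does every combination; conversely,
    the expansion of [v] in the standard basis then uses only that family. *)
Lemma mem_span_deltaP (k : fieldType) (m n : nat) (v : 'cV[k]_m) :
  reflect (forall i : 'I_m, (n <= i)%N -> v i 0 = 0)
    (v \in <<[seq (delta_mx i 0 : 'cV[k]_m)%R | i : 'I_m <- enum 'I_m
                & (i < n)%N]>>%VS).
Proof.
set e := map _ _; apply: (iffP idP) => [v_e i le_n_i | v0].
  rewrite (coord_span (X := in_tuple e) v_e) summxE big1 // => j _.
  have /mapP[l] : (in_tuple e)`_j \in e by rewrite mem_nth.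
  rewrite mem_filter => /andP[lt_l_n _] ->.
  rewrite !mxE andbT (_ : (i == l) = false) ?mulr0 //.
  by apply: contraTF lt_l_n => /eqP <-; rewrite -leqNgt.
rewrite (matrix_sum_delta v); apply: memv_suml => i _.
rewrite big_ord1; have [/v0 -> | lt_i_n] := leqP n i.
  by rewrite scale0r mem0v.
apply/memvZ/memv_span/mapP; exists i => //.
by rewrite mem_filter lt_i_n mem_enum.
Qed.

Lemma US2P (k : fieldType) (X : MatS2 k) :
  reflect [/\ X 1 c12 = 0, X 1 c13 = 0 & X 1 c24 = 0] (X \in US2 k).
Proof.
apply: (iffP forallP) => [X_up | [X12 X13 X24] c].
  have X1 c : (indS2 c <= 1)%N -> X 1 c = 0.
    by move/mem_span_deltaP: (X_up c) => /(_ 1); rewrite mxE.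
  by split; apply: X1.
apply/mem_span_deltaP => i; rewrite mxE; move: i c.
by elim/ord2P; elim/ord6P.
Qed.

Theorem proposition4p1 (k : fieldType)
    (char_neq2 : 2%N \notin [pchar k]) (char_neq3 : 3%N \notin [pchar k]) :
  is_subalgebra (US2 k).
Proof.
split; first split.
- by apply/US2P; split; rewrite mxE.
- move=> a X Y /US2P[X12 X13 X24] /US2P[Y12 Y13 Y24]; apply/US2P.
  by split; rewrite !mxE ?X12 ?X13 ?X24 ?Y12 ?Y13 ?Y24 mulr0 addr0.
move=> X Y /US2P[X12 X13 X24] /US2P[Y12 Y13 Y24]; apply/US2P.
by rewrite mulS2E; split;
  rewrite mxE /= ?X12 ?X13 ?X24 ?Y12 ?Y13 ?Y24 mul0r mulr0 addr0.
Qed.
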